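(* Let $G$ be a connected graph and $k$ a positive integer. Then $G$ admits a strongly $k$-uniform integer additive set-indexer if and only if $G$ is bipartite or $G$ admits a $(k,l)$-completely uniform integer additive set-indexer with $k=l^2$.
   Context: All graphs are simple, finite and have no isolated vertices. Set-labels are non-empty finite subsets of the non-negative integers $\mathbb{N}_0$. For sets $A,B$, $A+B=\{a+b: a\in A, b\in B\}$. An integer additive set-indexer (IASI) of $G$ is an injective $f:V(G)\to 2^{\mathbb{N}_0}$ such that $f^+:E(G)\to 2^{\mathbb{N}_0}$, $f^+(uv)=f(u)+f(v)$, is injective. An IASI is $k$-uniform if $|f^+(e)|=k$ for all edges $e$. It is strong if $|f^+(uv)|=|f(u)|\,|f(v)|$ for every edge $uv$, and strongly $k$-uniform if it is strong and $k$-uniform. An IASI $f$ is $(k,l)$-completely uniform if it is $k$-uniform and $|f(v)|=l$ for every vertex $v$. *)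

(* Defs.v *)
From HB Require Import structures.
From mathcomp Require Import all_boot finmap.

Set Implicit Arguments.
Unset Strict Implicit.
Unset Printing Implicit Defensive.

Local Open Scope fset_scope.
Local Open Scope nat_scope.

Record sgraph := SGraph {
  vertex :> finType;
  adj : rel vertex;
  adj_sym : symmetric adj;
  adj_irrefl : irreflexive adj }.

Definition no_isolated (G : sgraph) : Prop :=
  forall u : G, exists v : G, adj u v.

Definition connected_graph (G : sgraph) : Prop :=
  0 < #|G| /\ forall u v : G, connect (@adj G) u v.

Definition bipartite (G : sgraph) : Prop :=
  exists A : {set G}, forall u v : G, adj u v -> (u \in A) != (v \in A).

Definition sumset (A B : {fset nat}) : {fset nat} :=
  [fset a + b | a in A, b in B].

Section Labellings.

Variables (G : sgraph) (f : G -> {fset nat}).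

(* The label f^+(uv); it is symmetric in u and v, so it depends only on the
   edge uv. *)
Definition edge_label (u v : G) : {fset nat} := sumset (f u) (f v).

(* The edge uv is identified with the unordered pair [set u; v], so the last
   clause is injectivity of f^+ on E(G). *)
Definition iasi : Prop :=
  [/\ forall v : G, f v != fset0,
      injective f
    & forall u v x y : G, adj u v -> adj x y ->
        edge_label u v = edge_label x y -> [set u; v] = [set x; y]].

Definition uniform_iasi (k : nat) : Prop :=
  iasi /\ forall u v : G, adj u v -> #|` edge_label u v| = k.

Definition strong_iasi : Prop :=
  iasi /\
  forall u v : G, adj u v -> #|` edge_label u v| = #|` f u| * #|` f v|.

Definition strongly_uniform_iasi (k : nat) : Prop :=
  strong_iasi /\ uniform_iasi k.

Definition completely_uniform_iasi (k l : nat) : Prop :=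
  uniform_iasi k /\ forall v : G, #|` f v| = l.

End Labellings.

(* Main.v *)
Require Import Defs.
From HB Require Import structures.
From mathcomp Require Import all_boot finmap.
From mathcomp Require Import zify.

Set Implicit Arguments.
Unset Strict Implicit.
Unset Printing Implicit Defensive.

Local Open Scope nat_scope.

(** Along an edge uv of a strongly k-uniform labelling |f u| |f v| = k, so by
    connectedness only two label sizes l and k / l occur, and they alternate
    along edges. If they differ, the vertices with a label of size l form one
    side of a bipartition; if they agree, k = l^2 and f is completely uniform.
    Conversely, for a bipartite graph label one side by singletons and the other
    by intervals of length k, the i-th vertex having least label element 2^i:
    sums of two distinct powers of 2 determine the two exponents. *)

Definition interval_fset (c n : nat) : {fset nat} := [fset x in iota c n]%fset.

Lemma in_interval_fset c n x : (x \in interval_fset c n) = (c <= x < c + n).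
Proof. by rewrite in_fset_ /= mem_iota. Qed.

Lemma card_interval_fset c n : #|` interval_fset c n| = n.
Proof. by rewrite card_fseq undup_id ?iota_uniq // size_iota. Qed.

Lemma interval_fset_start c d m n :
  0 < m -> 0 < n -> interval_fset c m = interval_fset d n -> c = d.
Proof.
move=> m0 n0 /fsetP E; have := E c; have := E d.
rewrite !in_interval_fset; lia.
Qed.

Lemma mem_sumset (A B : {fset nat}) x :
  reflect (exists a b, [/\ a \in A, b \in B & x = a + b]) (x \in sumset A B).
Proof.
apply: (iffP idP) => [/imfset2P [a /= aA [b /= bB ->]]|[a [b [aA bB ->]]]].
  by exists a, b.
by apply/imfset2P; exists a => //; exists b.
Qed.

(** The sums run without gaps from [a + b] to [(a + m - 1) + (b + n - 1)], which makes [m + n - 1]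
    integers. *)
Lemma sumset_interval_fset a b m n : 0 < m -> 0 < n ->
  sumset (interval_fset a m) (interval_fset b n) =
    interval_fset (a + b) (m + n).-1.
Proof.
move=> m0 n0; apply/fsetP => x; rewrite in_interval_fset.
apply/mem_sumset/idP => [[y [z []]]|xab]; first by rewrite !in_interval_fset; lia.
(* Greedy splitting: the first summand is as large as its interval allows while leaving at least [b]
   for the second. *)
exists (minn (x - b) (a + m.-1)), (x - minn (x - b) (a + m.-1)).
by rewrite !in_interval_fset; split; lia.
Qed.

(** The 2-adic valuation of the sum is the smaller exponent, since the cofactor [1 + 2 ^ (j - i)] is
    odd; cancelling that power leaves the larger one. *)
Lemma sum_pow2_inj i j x y : i < j -> x < y ->
  2 ^ i + 2 ^ j = 2 ^ x + 2 ^ y -> i = x /\ j = y.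
Proof.
have val2 a b : a < b -> logn 2 (2 ^ a + 2 ^ b) = a.
  move=> ab; rewrite -(subnKC ab) addSn expnS expnD mulnCA -[X in X + _]muln1.
  rewrite -mulnDr lognM ?expn_gt0 // pfactorK // lognE.
  by rewrite dvdn_addl ?dvdn_mulr // andbF addn0.
move=> ij xy E; have ix : i = x by rewrite -(val2 i j) // E val2.
split=> //; move: E; rewrite ix => /addnI /eqP.
by rewrite eqn_exp2l // => /eqP.
Qed.

Lemma bipartite_strongly_uniform (G : sgraph) (k : nat) : 0 < k ->
  bipartite G -> exists f : G -> {fset nat}, strongly_uniform_iasi f k.
Proof.
move=> k0 [A HA].
pose c (v : G) := 2 ^ enum_rank v.
pose s (v : G) := if v \in A then 1 else k.
have s0 v : 0 < s v by rewrite /s; case: ifP.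
(* The sizes at the ends of an edge are [1] and [k]: the sumset then has length [1 + k - 1], equal
   to the product [1 * k]. *)
have ss u v : adj u v -> (s u + s v).-1 = k /\ s u * s v = k.
  by move=> /HA; rewrite /s; case: (u \in A); case: (v \in A) => // _; lia.
exists (fun v => interval_fset (c v) (s v)).
have edgeE u v : adj u v ->
    edge_label (fun v => interval_fset (c v) (s v)) u v
      = interval_fset (c u + c v) k.
  by move=> uv; rewrite /edge_label sumset_interval_fset // (ss _ _ uv).1.
have cS u v x y : enum_rank u < enum_rank v -> enum_rank x < enum_rank y ->
    c u + c v = c x + c y -> [set u; v] = [set x; y].
  move=> uv xy /(sum_pow2_inj uv xy) [/ord_inj/enum_rank_inj -> ].
  by move=> /ord_inj/enum_rank_inj ->.
have adjN (u v : G) : adj u v ->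
    (enum_rank u < enum_rank v) || (enum_rank v < enum_rank u).
  move=> uv; rewrite -neq_ltn; apply/eqP => /ord_inj/enum_rank_inj E.
  by move: uv; rewrite E adj_irrefl.
have I : iasi (fun v => interval_fset (c v) (s v)).
  split.
  - by move=> v; rewrite -cardfs_gt0 card_interval_fset.
  - move=> u v /(interval_fset_start (s0 u) (s0 v)) /eqP.
    by rewrite eqn_exp2l // => /eqP /ord_inj/enum_rank_inj.
  - move=> u v x y uv xy; rewrite !edgeE // => /(interval_fset_start k0 k0).
    (* Both edges are oriented by increasing rank, so that [cS] applies in each of the four
       cases. *)
    case/orP: (adjN _ _ uv) => uv'; case/orP: (adjN _ _ xy) => xy' E.
    + exact: cS.
    + by rewrite [RHS]setUC; apply: cS => //; rewrite E addnC.
    + by rewrite [LHS]setUC; apply: cS => //; rewrite -E addnC.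
    + by rewrite setUC [RHS]setUC; apply: cS => //; rewrite addnC E addnC.
split; split=> // u v uv; rewrite edgeE // !card_interval_fset //.
by rewrite (ss _ _ uv).2.
Qed.

Theorem theorem8 (G : sgraph) (k : nat) :
  no_isolated G -> connected_graph G -> 0 < k ->
  ((exists f : G -> {fset nat}, strongly_uniform_iasi f k) <->
   (bipartite G \/
    exists l : nat, k = l ^ 2 /\
      exists f : G -> {fset nat}, completely_uniform_iasi f k l)).
Proof.
move=> noiso [/card_gt0P [r _] conn] k0; split; last first.
  case=> [|[l [kE [f [[I U] L]]]]]; first exact: bipartite_strongly_uniform.
  by exists f; do 2!split=> //; move=> u v uv; rewrite U // !L kE mulnn.
case=> f [[_ S] [I U]].
have prodE u v : adj u v -> #|` f u| * #|` f v| = k.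
  by move=> uv; rewrite -S // U.
(* A neighbour of [r] realises the complementary size [k / l]. *)
have [w rw] := noiso r.
pose l := #|` f r|; pose m := #|` f w|.
have lm : l * m = k by exact: prodE.
have [l0 m0] : 0 < l /\ 0 < m by apply/andP; rewrite -muln_gt0 lm.
have swap u v : adj u v -> (#|` f u| == l -> #|` f v| == m)
    /\ (#|` f u| == m -> #|` f v| == l).
  move=> /prodE E; split=> /eqP uE; move: E; rewrite uE -lm.
    by move=> /eqP; rewrite eqn_pmul2l.
  by rewrite [RHS]mulnC => /eqP; rewrite eqn_pmul2l.
have two v : (#|` f v| == l) || (#|` f v| == m).
  pose a := [pred v | (#|` f v| == l) || (#|` f v| == m)].
  (* By [swap] the two sizes persist along edges, so connectedness spreads them from [r] to every
     vertex. *)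
  have cl : closed (@adj G) a.
    apply: (intro_closed (sym_connect_sym (@adj_sym G))) => x y /swap [X Y].
    by rewrite !inE => /orP [/X ->|/Y ->] //; rewrite orbT.
  have := closed_connect cl (conn r v).
  by rewrite !inE eqxx => <-.
have [lmE|lmN] := eqVneq l m.
  right; exists l; split; first by rewrite -lm -lmE mulnn.
  by exists f; split=> // v; move: (two v); rewrite -lmE orbb => /eqP.
left; exists [set v | #|` f v| == l] => u v uv; rewrite !inE.
have [X Y] := swap u v uv; case/orP: (two u) => uE.
  by rewrite uE (eqP (X uE)) [m == l]eq_sym (negbTE lmN).
by rewrite (Y uE) (eqP uE) [m == l]eq_sym (negbTE lmN).
Qed.
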